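(* Let $(\mathfrak g,\{\theta_k\}_{k\ge1})$ be a pre-Lie$_\infty$-algebra, and define $L_k:\mathsf S^{k-1}(\mathfrak g)\otimes\mathfrak g\to\mathfrak g$ by $L_k(x_1,\dots,x_{k-1},x_k)=\theta_k(x_1,\dots,x_{k-1},x_k)$ for $k\ge1$. Then $(\mathfrak g,\{L_k\}_{k\ge1})$ is a representation of the sub-adjacent $L_\infty$-algebra $\mathfrak g^C$. Moreover, the identity map $\mathrm{Id}:\mathfrak g\to\mathfrak g$ is a strict homotopy relative Rota-Baxter operator on the $L_\infty$-algebra $\mathfrak g^C$ with respect to the representation $(\mathfrak g,\{L_k\}_{k\ge1})$.
   Context: The base field has characteristic $0$; vector spaces are $\mathbb Z$-graded. $\mathsf S^k$ is the $k$-th graded symmetric power; $\varepsilon(\sigma)$ is the Koszul sign; $\mathbb S_{(i_1,\dots,i_k)}$ are the $(i_1,\dots,i_k)$-shuffles; in exponents, an element denotes its degree. Pre-Lie$_\infty$-algebra: a graded vector space $V$ with degree $1$ maps $\theta_k:\mathsf S^{k-1}(V)\otimes V\to V$ ($k\ge1$) such that for all $n\ge1$ and homogeneous $v_1,\dots,v_n\in V$, $$\sum_{\substack{i+j=n+1\\i\ge1,j\ge2}}\sum_{\sigma\in\mathbb S_{(i-1,1,j-2)}}\varepsilon(\sigma)\theta_j(\theta_i(v_{\sigma(1)},\dots,v_{\sigma(i)}),v_{\sigma(i+1)},\dots,v_{\sigma(n-1)},v_n)+\sum_{\substack{i+j=n+1\\i,j\ge1}}\sum_{\sigma\in\mathbb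 S_{(j-1,i-1)}}(-1)^{v_{\sigma(1)}+\cdots+v_{\sigma(j-1)}}\varepsilon(\sigma)\theta_j(v_{\sigma(1)},\dots,v_{\sigma(j-1)},\theta_i(v_{\sigma(j)},\dots,v_{\sigma(n-1)},v_n))=0.$$ $L_\infty$-algebra: a graded vector space $\mathfrak g$ with degree $1$ graded symmetric maps $l_k:\otimes^k\mathfrak g\to\mathfrak g$ ($k\ge1$) with $\sum_{i=1}^n\sum_{\sigma\in\mathbb S_{(i,n-i)}}\varepsilon(\sigma)l_{n-i+1}(l_i(x_{\sigma(1)},\dots,x_{\sigma(i)}),x_{\sigma(i+1)},\dots,x_{\sigma(n)})=0$ for all $n\ge1$. Sub-adjacent $L_\infty$-algebra $\mathfrak g^C$ of a pre-Lie$_\infty$-algebra $(\mathfrak g,\{\theta_k\})$: the $L_\infty$-algebra $(\mathfrak g,\{l_k\})$ with $l_k(x_1,\dots,x_k)=\sum_{i=1}^k(-1)^{x_i(x_{i+1}+\cdots+x_k)}\theta_k(x_1,\dots,\hat x_i,\dots,x_k,x_i)$. A representation of an $L_\infty$-algebra $(\mathfrak g,\{l_k\})$ on $V$: degree $1$ maps $\rho_k:\mathsf S^{k-1}(\mathfrak g)\otimes V\to V$ ($k\ge1$) such that for all $n\ge1$ and homogeneous $x_i\in\mathfrak g$, $v\in V$, $$\sum_{i=1}^{n-1}\sum_{\sigma\in\mathbb S_{(i,n-i-1)}}\varepsilon(\sigma)\rho_{n-i+1}(l_i(x_{\sigma(1)},\dots,x_{\sigma(i)}),x_{\sigma(i+1)},\dots,x_{\sigma(n-1)},v)+\sum_{i=1}^n\sum_{\sigma\in\mathbb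 S_{(n-i,i-1)}}\varepsilon(\sigma)(-1)^{x_{\sigma(1)}+\cdots+x_{\sigma(n-i)}}\rho_{n-i+1}(x_{\sigma(1)},\dots,x_{\sigma(n-i)},\rho_i(x_{\sigma(n-i+1)},\dots,x_{\sigma(n-1)},v))=0.$$ Strict homotopy relative Rota-Baxter operator on $(\mathfrak g,\{l_k\})$ with respect to $(V,\{\rho_k\})$: a degree $0$ map $T\in\mathrm{Hom}(V,\mathfrak g)$ with, for all $p\ge1$ and homogeneous $v_i\in V$, $l_p(Tv_1,\dots,Tv_p)=\sum_{i=1}^p(-1)^{(v_{i+1}+\cdots+v_p)v_i}T\rho_p(Tv_1,\dots,Tv_{i-1},Tv_{i+1},\dots,Tv_p,v_i)$. *)

(* Defs.v *)
From HB Require Import structures.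
From mathcomp Require Import all_boot all_order all_algebra all_fingroup.

Set Implicit Arguments.
Unset Strict Implicit.
Unset Printing Implicit Defensive.

Import GRing.Theory.
Local Open Scope ring_scope.

(* A Z-graded vector space is the internal direct sum of the subspaces
   [gcomp d].  A pair (d, x) : int * V stands for an element x together with
   the degree d assigned to it (0 belongs to every component). *)
Record gradedSpace (K : fieldType) := GradedSpace {
  gspace :> lmodType K;
  gcomp : int -> {pred gspace};
  gcomp_submod : forall d, submod_closed (gcomp d);
  gcomp_span : forall x : gspace, exists t : seq (int * gspace),
    [&& uniq (unzip1 t), all (fun p => p.2 \in gcomp p.1) t
      & x == \sum_(p <- t) p.2];
  gcomp_indep : forall t : seq (int * gspace),
    uniq (unzip1 t) -> all (fun p => p.2 \in gcomp p.1) t ->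
    \sum_(p <- t) p.2 = 0 -> forall p, p \in t -> p.2 = 0 }.

Arguments gcomp {K} _ _.

Definition homogeneous (K : fieldType) (V : gradedSpace K)
    (t : seq (int * V)) : bool :=
  all (fun p => p.2 \in gcomp V p.1) t.

Definition gdecomp (K : fieldType) (V : gradedSpace K) (x : V) :
    seq (int * V) := xchoose (gcomp_span x).

Definition gsign (K : fieldType) (d : int) : K := (-1) ^ d.

(* sigma(1), ..., sigma(n) cut into consecutive blocks of lengths s, each of
   which has to be increasing. *)
Definition shuffle (n : nat) (s : seq nat) (sigma : 'S_n) : bool :=
  (sumn s == n) &&
  all (sorted ltn) (reshape s [seq val (sigma a) | a <- enum 'I_n]).

(* The Koszul sign: v_1 ... v_n = koszul d sigma * v_sigma(1) ... v_sigma(n)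
   in the graded symmetric algebra, where d a is the degree of v_a. *)
Definition koszul (K : fieldType) (n : nat) (d : 'I_n -> int) (sigma : 'S_n) :
    K :=
  \prod_(a < n) \prod_(b < n | (a < b)%N && (sigma b < sigma a)%N)
     gsign K (d (sigma a) * d (sigma b)).

Definition word (n : nat) (X : Type) (v : 'I_n -> X) (sigma : 'S_n) : seq X :=
  [seq v (sigma a) | a <- enum 'I_n].

(* A family of maps f_k : S^(k-1)(U) (x) W -> W, k >= 1, is encoded as a single
   function with f_k(u_1, ..., u_(k-1), w) = f [:: u_1; ...; u_(k-1)] w; linear
   maps out of S^(k-1)(U) (x) W are multilinear maps that are graded symmetric
   in their first k-1 arguments. *)
Record sym_tensor_maps (K : fieldType) (U W : gradedSpace K)
    (f : seq U -> W -> W) : Prop := SymTensorMaps {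
  stm_linear_sym : forall (s1 s2 : seq U) (a : K) (x y : U) (w : W),
    f (s1 ++ (a *: x + y) :: s2) w
      = a *: f (s1 ++ x :: s2) w + f (s1 ++ y :: s2) w;
  stm_linear : forall s : seq U, linear (f s);
  stm_sym : forall (s1 s2 : seq U) (p q : int) (x y : U) (w : W),
    x \in gcomp U p -> y \in gcomp U q ->
    f (s1 ++ [:: x, y & s2]) w = gsign K (p * q) *: f (s1 ++ [:: y, x & s2]) w;
  stm_degree1 : forall (t : seq (int * U)) (e : int) (w : W),
    homogeneous t -> w \in gcomp W e ->
    f (unzip2 t) w \in gcomp W (\sum_(p <- t) p.1 + e + 1) }.

(* A family of maps l_k : (x)^k U -> U, k >= 1, is encoded as a single function
   on sequences, whose value on the empty sequence is never used. *)
Record sym_maps (K : fieldType) (U : gradedSpace K) (l : seq U -> U) : Prop :=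
  SymMaps {
  sm_linear : forall (s1 s2 : seq U) (a : K) (x y : U),
    l (s1 ++ (a *: x + y) :: s2) = a *: l (s1 ++ x :: s2) + l (s1 ++ y :: s2);
  sm_sym : forall (s1 s2 : seq U) (p q : int) (x y : U),
    x \in gcomp U p -> y \in gcomp U q ->
    l (s1 ++ [:: x, y & s2]) = gsign K (p * q) *: l (s1 ++ [:: y, x & s2]);
  sm_degree1 : forall t : seq (int * U),
    (0 < size t)%N -> homogeneous t ->
    l (unzip2 t) \in gcomp U (\sum_(p <- t) p.1 + 1) }.

(* The n-th defining identity of the usual presentation, with its last argument
   singled out as w, is the instance of pl_rel for n.-1 elements v; hence the
   condition i + j = n + 1 becomes i + j = n.+2 here. *)
Record preLie_infty (K : fieldType) (V : gradedSpace K)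
    (theta : seq V -> V -> V) : Prop := PreLieInfty {
  pl_maps : sym_tensor_maps theta;
  pl_rel : forall (n : nat) (d : 'I_n -> int) (v : 'I_n -> V) (e : int) (w : V),
    (forall a, v a \in gcomp V (d a)) -> w \in gcomp V e ->
    \sum_(1 <= i < n.+2) \sum_(2 <= j < n.+2 | (i + j == n.+2)%N)
      \sum_(sigma : 'S_n | shuffle [:: i.-1; 1%N; j.-2] sigma)
        koszul K d sigma *:
          (let x := word v sigma in
           theta (theta (take i.-1 x) x`_i.-1 :: drop i x) w)
    + \sum_(1 <= i < n.+2) \sum_(1 <= j < n.+2 | (i + j == n.+2)%N)
      \sum_(sigma : 'S_n | shuffle [:: j.-1; i.-1] sigma)
        (gsign K (\sum_(c <- take j.-1 (word d sigma)) c) * koszul K d sigma) *: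
          (let x := word v sigma in
           theta (take j.-1 x) (theta (drop j.-1 x) w))
    = 0 }.

Record L_infty (K : fieldType) (U : gradedSpace K) (l : seq U -> U) : Prop :=
  LInfty {
  L_maps : sym_maps l;
  L_rel : forall (n : nat) (d : 'I_n -> int) (x : 'I_n -> U), (0 < n)%N ->
    (forall a, x a \in gcomp U (d a)) ->
    \sum_(1 <= i < n.+1) \sum_(sigma : 'S_n | shuffle [:: i; (n - i)%N] sigma)
      koszul K d sigma *:
        (let y := word x sigma in l (l (take i y) :: drop i y))
    = 0 }.

(* As in pl_rel, the n-th identity is the instance of rep_rel for n.-1
   elements x of U and one element v of W. *)
Record L_infty_rep (K : fieldType) (U W : gradedSpace K)
    (l : seq U -> U) (rho : seq U -> W -> W) : Prop := LInftyRep {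
  rep_L_infty : L_infty l;
  rep_maps : sym_tensor_maps rho;
  rep_rel : forall (n : nat) (d : 'I_n -> int) (x : 'I_n -> U) (e : int) (v : W),
    (forall a, x a \in gcomp U (d a)) -> v \in gcomp W e ->
    \sum_(1 <= i < n.+1) \sum_(sigma : 'S_n | shuffle [:: i; (n - i)%N] sigma)
      koszul K d sigma *:
        (let y := word x sigma in rho (l (take i y) :: drop i y) v)
    + \sum_(1 <= i < n.+2)
      \sum_(sigma : 'S_n | shuffle [:: (n.+1 - i)%N; i.-1] sigma)
        (koszul K d sigma *
         gsign K (\sum_(c <- take (n.+1 - i) (word d sigma)) c)) *:
          (let y := word x sigma in
           rho (take (n.+1 - i) y) (rho (drop (n.+1 - i) y) v))
    = 0 }.

Record strict_homotopy_relative_RB (K : fieldType) (U W : gradedSpace K)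
    (l : seq U -> U) (rho : seq U -> W -> W) (T : W -> U) : Prop := StrictRB {
  rb_rep : L_infty_rep l rho;
  rb_linear : linear T;
  rb_degree0 : forall (d : int) (v : W), v \in gcomp W d -> T v \in gcomp U d;
  rb_rel : forall (p : nat) (d : 'I_p -> int) (v : 'I_p -> W), (0 < p)%N ->
    (forall i, v i \in gcomp W (d i)) ->
    l [seq T (v i) | i <- enum 'I_p] =
    \sum_(i < p) gsign K ((\sum_(j < p | (i < j)%N) d j) * d i) *:
      T (rho [seq T (v j) | j <- enum 'I_p & j != i] (v i)) }.

(* Extends F, given on homogeneous elements, multilinearly to all elements. *)
Fixpoint multilinear_ext (K : fieldType) (U W : gradedSpace K)
    (F : seq (int * U) -> W) (s : seq U) : W :=
  if s is x :: s' then
    \sum_(p <- gdecomp x) multilinear_ext (fun t => F (p :: t)) s'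
  else F [::].

Definition subadjacent_hom (K : fieldType) (V : gradedSpace K)
    (theta : seq V -> V -> V) (t : seq (int * V)) : V :=
  let d := unzip1 t in
  let x := unzip2 t in
  \sum_(i < size t)
    gsign K (d`_i * \sum_(c <- drop i.+1 d) c) *:
      theta (take i x ++ drop i.+1 x) x`_i.

(* The operations of the sub-adjacent L_infty-algebra; see [subadjacentE] for
   their values on homogeneous elements. *)
Definition subadjacent (K : fieldType) (V : gradedSpace K)
    (theta : seq V -> V -> V) : seq V -> V :=
  multilinear_ext (subadjacent_hom theta).

Lemma sum_gdecomp (K : fieldType) (U : gradedSpace K) (M : zmodType)
    (G : int * U -> M) (d : int) (x : U) :
  x \in gcomp U d -> (forall c, G (c, 0) = 0) ->
  \sum_(p <- gdecomp x) G p = G (d, x).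
Proof.
move=> xd G0; rewrite /gdecomp.
have /and3P[] := xchooseP (gcomp_span x).
move: (xchoose _) => t ut ht /eqP xE.
have [_ lind] := gcomp_submod U d.
have z0 : (0 : U) \in gcomp U d by case: (gcomp_submod U d).
have nxd : - x \in gcomp U d by rewrite -scaleN1r -[_ *: _]addr0 lind.
pose t' := [seq p <- t | p.1 != d].
have ut' : uniq (unzip1 t').
  by apply: (subseq_uniq _ ut); apply: map_subseq; apply: filter_subseq.
pose y := \sum_(p <- t | p.1 == d) p.2.
have yd : y \in gcomp U d.
  rewrite /y big_seq_cond; apply: (big_ind (fun z => z \in gcomp U d)) => // [a b ad bd|p].
    by rewrite -[a]scale1r lind.
  by case/andP=> pt /eqP <-; apply: (allP ht).
have yxd : y - x \in gcomp U d by rewrite -[y]scale1r lind.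
have zt : forall p, p \in (d, y - x) :: t' -> p.2 = 0.
  apply: gcomp_indep.
  - rewrite /= ut' andbT; apply/mapP=> -[p]; rewrite mem_filter => /andP[pd _] E.
    by rewrite E eqxx in pd.
  - rewrite /= yxd; apply/allP=> p; rewrite mem_filter => /andP[_ pt].
    exact: (allP ht).
  rewrite big_cons /t' big_filter /= addrAC -/y.
  have := xE; rewrite (bigID (fun p : int * U => p.1 == d)) /= -/y => xE'.
  by apply/eqP; rewrite subr_eq0 -xE'.
have xy : y = x by apply/eqP; rewrite -subr_eq0; apply/eqP/(zt (d, y - x))/mem_head.
rewrite (bigID (fun p : int * U => p.1 == d)) /= [X in _ + X]big_seq_cond.
rewrite [X in _ + X]big1 ?addr0 => [|[c z] /andP[pt pd]]; last first.
  have /= -> := zt (c, z); first exact: G0.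
  by rewrite inE mem_filter pt pd orbT.
move: xy; rewrite /y {t' ut' zt yxd yd y}; clear -ut G0.
elim: t ut => [_|[c z] t IH /= /andP[ct ut]]; first by rewrite !big_nil => <-.
rewrite !big_cons /=; case: eqVneq ct => [->|_ _]; last exact: IH.
move=> dt; have nd p : p \in t -> (p.1 == d) = false.
  by move=> pt; apply: contraNF dt => /eqP <-; apply: map_f.
have S (M' : zmodType) (H : int * U -> M') : \sum_(p <- t | p.1 == d) H p = 0.
  by rewrite big_seq_cond big1 // => p /andP[/nd ->].
by rewrite !S !addr0 => ->.
Qed.

Lemma multilinear_extE (K : fieldType) (U W : gradedSpace K)
    (F : seq (int * U) -> W) (t : seq (int * U)) :
  (forall t1 t2 d, F (t1 ++ (d, 0) :: t2) = 0) -> homogeneous t ->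
  multilinear_ext F (unzip2 t) = F t.
Proof.
elim: t F => [//|[d x] t IH] F F0 /= /andP[xd ht].
have E p : multilinear_ext (fun s => F (p :: s)) (unzip2 t) = F (p :: t).
  by rewrite IH // => t1 t2 c; apply: (F0 (p :: t1)).
rewrite (eq_bigr _ (fun p _ => E p)) (sum_gdecomp (G := fun p => F (p :: t)) xd) //.
by move=> c; apply: (F0 [::]).
Qed.

Lemma subadjacentE (K : fieldType) (V : gradedSpace K)
    (theta : seq V -> V -> V) (t : seq (int * V)) :
  sym_tensor_maps theta -> homogeneous t ->
  subadjacent theta (unzip2 t) = subadjacent_hom theta t.
Proof.
move=> th; apply: multilinear_extE => t1 t2 d.
have th0 s1 s2 w : theta (s1 ++ 0 :: s2) w = 0.
  have := stm_linear_sym th s1 s2 (-1) 0 0 w.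
  by rewrite scaler0 add0r scaleN1r addNr.
have thw s : theta s 0 = 0.
  have := stm_linear th s (-1) 0 0.
  by rewrite scaler0 add0r scaleN1r addNr.
rewrite /subadjacent_hom big1 // => i _.
rewrite /unzip2 map_cat /=.
move: [seq _ | _ <- t1] [seq _ | _ <- t2] (val i) => x1 x2 k.
suff -> : theta (take k (x1 ++ 0 :: x2) ++ drop k.+1 (x1 ++ 0 :: x2))
      (x1 ++ 0 :: x2)`_k = 0 by rewrite scaler0.
rewrite take_cat drop_cat nth_cat.
case: (ltngtP k (size x1)) => [lt|gt|->].
- move: (lt); rewrite leq_eqVlt => /predU1P[->|lt'].
    by rewrite ltnn subnn drop0; apply: th0.
  by rewrite lt' catA; apply: th0.
- rewrite ltnNge (leqW (ltnW gt)) /= subSn ?(ltnW gt) //.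
  by rewrite -(subnSK gt) /= -catA; apply: th0.
by rewrite subnn; apply: thw.
Qed.

(* Main.v *)
Require Import Defs.
From mathcomp Require Import all_boot all_order all_algebra all_fingroup.
From mathcomp Require Import ring zify.

Set Implicit Arguments.
Unset Strict Implicit.
Unset Printing Implicit Defensive.

Import GRing.Theory.
Local Open Scope ring_scope.

(** The Koszul-signed sum over (i, n - i)-shuffles, taken over all i, is the
    coproduct of the graded symmetric coalgebra.  It is written here as a
    functional [unshuffle_sum]: [unshuffle_sum G t] is the sum of
    eps * G a b over all ways of unshuffling the word t into two words a and b.
    Its definition is a recursion on t (the first letter either joins a for
    free, or joins b and pays the sign of jumping over a), so coassociativity
    ([unshuffle_sum_coassoc]) and graded cocommutativity
    ([unshuffle_sum_cocomm]) are short inductions, and no permutation is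
    handled after the sums over shuffles have been translated
    ([sum_shuffle_head], [sum_shuffle_tail], [sum_shuffle_pick]).

    Write l for the sub-adjacent operations.  Then l t is the unshuffle sum of
    theta(a; x) over the pairs (a, [x]).  Hence, by coassociativity, picking the
    middle letter of the (i - 1, 1, j - 2)-shuffles in the pre-Lie relation only
    assembles l, and the relation becomes [preLie_unshuffle_sum]:
      sum of theta(l(a), b; w) + sum of (-1)^|a| theta(a; theta(b; w)) = 0,
    which is word for word the representation relation.

    For the L_infty relation, expand the outer l in l(l(a), b) according to the
    letter that goes to the last slot of theta.  If it is a letter x of b, the
    terms are theta(l(a), u; x).  If it is l(a), the term is
    +- theta(b; l(a)), and cocommutativity together with the expansion of
    l(a) turns the sum of these into that of (-1)^|a| theta(a; theta(c; x)).  By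
    coassociativity both families are indexed by first splitting off x, so
    their total is the sum over the letters x of the pre-Lie relation with w = x
    ([subadjacent_Jacobi]).  Finally, the Rota-Baxter relation for the identity
    is the definition of l. *)

(** * Signed sums over unshuffles *)

Section Signs.
Variable K : fieldType.

Lemma gsignD (a b : int) : gsign K (a + b) = gsign K a * gsign K b.
Proof. by rewrite /gsign expfzDr // oppr_eq0 oner_eq0. Qed.

Lemma gsign_sqr (a : int) : gsign K a * gsign K a = 1.
Proof. by rewrite /gsign -exprMz_comm ?mulrNN ?mulr1 ?exp1rz //; apply: unitrN1. Qed.

End Signs.

Section UnshuffleSum.
Variables (K : fieldType) (T : eqType) (deg : T -> int).

Definition degs (t : seq T) : int := \sum_(x <- t) deg x.

(** The coproduct of the graded symmetric coalgebra, in continuation style: G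
    stands for a bilinear map on the two tensor factors, so that applying a
    linear map to it, or iterating it, needs no type of tensors. *)
Fixpoint unshuffle_sum (M : lmodType K) (G : seq T -> seq T -> M)
    (t : seq T) : M :=
  if t is x :: t' then
    unshuffle_sum (fun a b => G (x :: a) b) t'
    + unshuffle_sum (fun a b => gsign K (deg x * degs a) *: G a (x :: b)) t'
  else G [::] [::].

Lemma degs_cons x t : degs (x :: t) = deg x + degs t.
Proof. exact: big_cons. Qed.

Lemma degs_cat a b : degs (a ++ b) = degs a + degs b.
Proof. exact: big_cat. Qed.

Lemma degs_perm a b : perm_eq a b -> degs a = degs b.
Proof. by move=> ab; apply: perm_big. Qed.

Section OneModule.
Variable M : lmodType K.
Implicit Types (G H : seq T -> seq T -> M) (t : seq T).

(** Through [perm_eq], the two words inherit from t everything that does not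
    depend on the order: size, total degree, homogeneity. *)
Lemma eq_unshuffle_sum G H t :
  (forall a b, perm_eq (a ++ b) t -> G a b = H a b) ->
  unshuffle_sum G t = unshuffle_sum H t.
Proof.
elim: t G H => [|x t IH] G H GH /=; first exact: GH.
congr (_ + _); apply: IH => a b ab.
  by apply: GH; rewrite /= perm_cons.
by rewrite GH // (perm_catCA a [:: x] b) perm_cons.
Qed.

Lemma unshuffle_sum0 t : unshuffle_sum (fun _ _ => 0 : M) t = 0.
Proof.
elim: t => [//|x t IH] /=; rewrite IH add0r -[RHS]IH.
by apply: eq_unshuffle_sum => *; rewrite scaler0.
Qed.

Lemma unshuffle_sumD G H t :
  unshuffle_sum (fun a b => G a b + H a b) t = unshuffle_sum G t + unshuffle_sum H t.
Proof.
elim: t G H => [//|x t IH] G H /=; rewrite IH addrACA; congr (_ + _).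
by rewrite -IH; apply: eq_unshuffle_sum => *; rewrite scalerDr.
Qed.

Lemma unshuffle_sum_sum (I : Type) (r : seq I) (P : pred I)
    (G : I -> seq T -> seq T -> M) t :
  \sum_(i <- r | P i) unshuffle_sum (G i) t
  = unshuffle_sum (fun a b => \sum_(i <- r | P i) G i a b) t.
Proof.
elim: r => [|i r IH].
  rewrite big_nil -[LHS](unshuffle_sum0 t).
  by apply: eq_unshuffle_sum => *; rewrite big_nil.
rewrite big_cons IH; case: ifP => Pi; last first.
  by apply: eq_unshuffle_sum => *; rewrite big_cons Pi.
by rewrite -unshuffle_sumD; apply: eq_unshuffle_sum => *; rewrite big_cons Pi.
Qed.

End OneModule.

Lemma unshuffle_sum_linear (M N : lmodType K) (f : M -> N)
    (G : seq T -> seq T -> M) t : linear f ->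
  f (unshuffle_sum G t) = unshuffle_sum (fun a b => f (G a b)) t.
Proof.
move=> flin.
have f0 : f 0 = 0 by have := flin (-1) 0 0; rewrite !scaleN1r oppr0 addr0 addNr.
have fD x y : f (x + y) = f x + f y by have := flin 1 x y; rewrite !scale1r.
have fZ a x : f (a *: x) = a *: f x by have := flin a x 0; rewrite f0 !addr0.
elim: t G => [//|x t IH] G /=; rewrite fD !IH; congr (_ + _).
by apply: eq_unshuffle_sum => *; rewrite fZ.
Qed.

Section OneModule.
Variable M : lmodType K.
Implicit Types (G : seq T -> seq T -> M) (t : seq T).

Lemma unshuffle_sumZ c G t : unshuffle_sum (fun a b => c *: G a b) t = c *: unshuffle_sum G t.
Proof.
rewrite (unshuffle_sum_linear (f := fun x => c *: x)) // => a x y.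
by rewrite scalerDr !scalerA mulrC.
Qed.

Lemma unshuffle_sum_counitr (H : seq T -> M) t :
  unshuffle_sum (fun a b => if b is [::] then H a else 0) t = H t.
Proof.
elim: t H => [//|x t IH] H /=; rewrite IH -[RHS]addr0; congr (_ + _).
by rewrite -[RHS](unshuffle_sum0 M t); apply: eq_unshuffle_sum => *; rewrite scaler0.
Qed.

Lemma unshuffle_sum_coassoc (G : seq T -> seq T -> seq T -> M) t :
  unshuffle_sum (fun a b => unshuffle_sum (fun c d => G c d b) a) t
  = unshuffle_sum (fun c e => unshuffle_sum (fun d b => G c d b) e) t.
Proof.
elim: t G => [//|x t IH] G /=; rewrite unshuffle_sumD -addrA IH; congr (_ + _).
transitivity (unshuffle_sum (fun c e =>
    unshuffle_sum (fun d b => gsign K (deg x * degs c) *: G c (x :: d) b) e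
    + unshuffle_sum (fun d b => gsign K (deg x * (degs c + degs d)) *: G c d (x :: b)) e) t).
  rewrite unshuffle_sumD -!IH; congr (_ + _); apply: eq_unshuffle_sum => a b _.
  rewrite -unshuffle_sumZ; apply: eq_unshuffle_sum => c d cd.
  by rewrite -degs_cat (degs_perm cd).
apply: eq_unshuffle_sum => c e _; rewrite scalerDr -!unshuffle_sumZ; congr (_ + _).
by apply: eq_unshuffle_sum => d b _; rewrite scalerA -gsignD mulrDr.
Qed.

Lemma unshuffle_sum_cocomm G t :
  unshuffle_sum G t = unshuffle_sum (fun a b => gsign K (degs a * degs b) *: G b a) t.
Proof.
elim: t G => [|x t IH] G /=; first by rewrite /degs big_nil mul0r /gsign expr0z scale1r.
rewrite addrC IH [in X in _ + X]IH; congr (_ + _); apply: eq_unshuffle_sum => a b _.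
  by rewrite scalerA -gsignD degs_cons; congr (gsign K _ *: _); ring.
rewrite scalerA degs_cons mulrDr gsignD mulrA [degs a * deg x]mulrC gsign_sqr.
by rewrite mul1r.
Qed.

End OneModule.
End UnshuffleSum.

(** The component of the coproduct whose second factor is one letter; its sign
    is that of moving the letter to the end of the word. *)
Lemma unshuffle_sum_single (K : fieldType) (T : eqType) (deg : T -> int) 
    (x0 : T) (M : lmodType K) (H : seq T -> T -> M) (t : seq T) :
  unshuffle_sum deg (fun a s => if s is [:: p] then H a p else 0) t
  = \sum_(i < size t)
      gsign K (deg (nth x0 t i) * degs deg (drop i.+1 t)) *:
        H (take i t ++ drop i.+1 t) (nth x0 t i).
Proof.
elim: t H => [|x t IH] H; first by rewrite /= big_ord0.
rewrite big_ord_recl /= drop0 addrC IH; congr (_ + _).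
rewrite -[RHS](unshuffle_sum_counitr deg
  (fun a => gsign K (deg x * degs deg t) *: H a x)).
apply: eq_unshuffle_sum => a [|q b]; last by rewrite scaler0.
by rewrite cats0 => /degs_perm ->.
Qed.

Lemma unshuffle_sum_map (K : fieldType) (T T' : eqType) (deg : T -> int)
    (deg' : T' -> int) (f : T -> T') (M : lmodType K)
    (G : seq T' -> seq T' -> M) (t : seq T) :
  (forall x, deg' (f x) = deg x) ->
  unshuffle_sum deg' G (map f t)
  = unshuffle_sum deg (fun a b => G (map f a) (map f b)) t.
Proof.
move=> degf; elim: t G => [//|x t IH] G /=; rewrite !IH; congr (_ + _).
apply: eq_unshuffle_sum => a b _; rewrite degf /degs big_map.
by under eq_bigr do rewrite degf.
Qed.

(** * Shuffle permutations as words *)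

Section ShuffleLists.
Variable n : nat.
Notation T := 'I_n.
Implicit Types (t l a b : seq T) (s : seq nat).

Definition ord_lt : rel T := fun x y => (x < y)%N.

Lemma ord_lt_trans : transitive ord_lt.
Proof. by move=> y x z; apply: ltn_trans. Qed.

Lemma sorted_ord_ltE t : sorted ord_lt t = sorted ltn (map val t).
Proof. by rewrite sorted_map. Qed.

(** [splits] and [shuffles] generate recursively the words that the shuffles
    spell; the sums over permutations are transported to these lists because
    they are uniq and have the right members. *)
Fixpoint splits t : seq (seq T * seq T) :=
  if t is x :: t' then
    [seq (x :: p.1, p.2) | p <- splits t']
    ++ [seq (p.1, x :: p.2) | p <- splits t']
  else [:: ([::], [::])].

Fixpoint shuffles s t : seq (seq T) :=
  if s is k :: s' then
    [seq p.1 ++ l | p <- [seq p <- splits t | size p.1 == k],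
                    l <- shuffles s' p.2]
  else if t is [::] then [:: [::]] else [::].

(** The letters of t are increasing, so its first letter must head one of the
    two sorted words, which is the recursion defining [splits]. *)
Lemma mem_splits t a b : sorted ord_lt t ->
  ((a, b) \in splits t) = [&& perm_eq (a ++ b) t, sorted ord_lt a & sorted ord_lt b].
Proof.
elim: t a b => [|x t IH] a b.
  move=> _ /=; rewrite inE; apply/eqP/and3P => [[-> ->] //|[/perm_nilP]].
  by case: a b => [|? ?] [].
move=> xt; have st := path_sorted xt.
have xlt y : y \in t -> ord_lt x y.
  by move=> yt; apply: (allP (order_path_min ord_lt_trans xt)).
have xs c : {subset c <= t} -> sorted ord_lt c -> path ord_lt x c.
  move=> ct sc; rewrite path_min_sorted //.
  by apply/allP=> y /ct /xlt.
rewrite /= mem_cat; apply/orP/and3P.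
  case=> /mapP[[a' b'] /= pin [-> ->]]; move: pin; rewrite IH // => /and3P[pe sa sb].
    split=> //=; first by rewrite perm_cons.
    by apply: xs => // y ya; rewrite -(perm_mem pe) mem_cat ya.
  split=> //=; first by rewrite (perm_catCA a' [:: x] b') perm_cons.
  by apply: xs => // y yb; rewrite -(perm_mem pe) mem_cat yb orbT.
case=> pe sa sb; have : x \in a ++ b by rewrite (perm_mem pe) mem_head.
have ux : uniq (a ++ b).
  rewrite (perm_uniq pe) (sorted_uniq ord_lt_trans _ xt) // => y.
  by rewrite /ord_lt ltnn.
(* A sorted word of letters of x :: t that contains x starts with x. *)
have hd y c : {subset y :: c <= x :: t} -> sorted ord_lt (y :: c) ->
    x \in y :: c -> y = x.
  move=> sub syc; rewrite inE => /predU1P[-> //|xc].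
  have yx : ord_lt y x by apply: (allP (order_path_min ord_lt_trans syc)).
  have := sub y (mem_head _ _); rewrite inE => /predU1P[//|/xlt].
  by rewrite /ord_lt ltnNge (ltnW yx).
rewrite mem_cat => /orP[xa|xb]; [left|right].
  case: a sa pe ux xa => [//|y a] sa pe ux xa.
  have yx : y = x by apply: (hd y a) => // z za; rewrite -(perm_mem pe) mem_cat za.
  rewrite yx in sa pe *; apply/mapP; exists (a, b) => //.
  by rewrite IH // sb (path_sorted sa) -(perm_cons x) pe.
case: b sb pe ux xb => [//|y b] sb pe ux xb.
have yx : y = x by apply: (hd y b) => // z zb; rewrite -(perm_mem pe) mem_cat zb orbT.
rewrite yx in sb pe *; apply/mapP; exists (a, b) => //.
by rewrite IH // sa (path_sorted sb) perm_catC -(perm_cons x) -cat_cons perm_catC pe.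
Qed.

Lemma sorted_ord_lt_uniq t : sorted ord_lt t -> uniq t.
Proof. by apply: (sorted_uniq ord_lt_trans) => y; rewrite /ord_lt ltnn. Qed.

Lemma uniq_splits t : uniq t -> uniq (splits t).
Proof.
have sub u p x : p \in splits u -> x \in p.1 -> x \in u.
  elim: u p => [|y u IH] p /=; first by rewrite inE => /eqP ->.
  rewrite mem_cat => /orP[] /mapP[q qin ->] /=; rewrite !inE.
    by case/predU1P=> [->|/(IH _ qin) ->]; rewrite ?eqxx ?orbT.
  by move/(IH _ qin) ->; rewrite orbT.
elim: t => [//|x t IH] /= /andP[xt ut].
rewrite cat_uniq !map_inj_uniq ?IH // => [|[? ?] [? ?] [-> ->] //|[? ?] [? ?] [-> ->] //].
rewrite andbT; apply/hasPn=> _ /mapP[p pin ->]; apply: contra xt.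
by case/mapP=> q qin [E _]; apply: (sub t p) => //; rewrite E mem_head.
Qed.

Lemma mem_shuffles s t l : sorted ord_lt t ->
  (l \in shuffles s t)
  = [&& perm_eq l t, sumn s == size t & all (sorted ord_lt) (reshape s l)].
Proof.
elim: s t l => [|k s IH] t l st.
  rewrite /= andbT; case: t {st} => [|x t] /=.
    by rewrite inE eqxx andbT; apply/eqP/perm_nilP.
  by rewrite andbF.
apply/allpairsPdep/and3P=> /=.
  case=> -[a b] [l' [/=]]; rewrite mem_filter mem_splits //=.
  move=> /andP[/eqP ka /and3P[pe sa sb]].
  rewrite IH // => /and3P[pl /eqP sz srt] ->; split.
  - by rewrite (perm_trans _ pe) // perm_cat2l.
  - by rewrite sz -(perm_size pe) size_cat ka.
  - by rewrite take_size_cat // drop_size_cat // sa.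
case=> pe /eqP sz /andP[sa srt].
have kl : (k <= size l)%N by rewrite (perm_size pe) -sz leq_addr.
(* The letters left after the first block, in increasing order. *)
pose b := sort (fun x y : T => x <= y)%N (drop k l).
have ub : uniq b.
  rewrite sort_uniq drop_uniq // (perm_uniq pe).
  by rewrite (sorted_uniq ord_lt_trans _ st) // => y; rewrite /ord_lt ltnn.
have pb : perm_eq b (drop k l) by rewrite perm_sort.
have sb : sorted ord_lt b.
  have := sort_sorted (leT := fun x y : T => (x <= y)%N)
    (fun x y => leq_total x y) (drop k l).
  rewrite -/b => sb; rewrite sorted_ord_ltE ltn_sorted_uniq_leq.
  by rewrite (map_inj_uniq val_inj) ub sorted_map.
exists (take k l, b), (drop k l); split => /=; last by rewrite cat_take_drop.
  rewrite mem_filter size_takel //= eqxx mem_splits // sa sb /= andbT.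
  by rewrite (perm_trans _ pe) // -[X in perm_eq _ X](cat_take_drop k) perm_cat2l.
rewrite IH // perm_sym pb srt andbT /=.
by rewrite size_sort size_drop (perm_size pe) -sz addKn.
Qed.

Lemma uniq_shuffles s t : sorted ord_lt t -> uniq (shuffles s t).
Proof.
elim: s t => [|k s IH] t st; first by case: t {st}.
apply: allpairs_uniq_dep.
- by rewrite filter_uniq // uniq_splits // sorted_ord_lt_uniq.
- move=> [a b]; rewrite mem_filter mem_splits // => /andP[_ /and3P[_ _]].
  exact: IH.
move=> u v /allpairsPdep[[a b] [l [pin lin ->]]].
move=> /allpairsPdep[[a' b'] [l' [qin lin' ->]]] /= E.
move: pin qin lin lin'; rewrite !mem_filter !mem_splits //=.
case/and4P=> /eqP ka pe sa sb /and4P[/eqP ka' pe' sa' sb'] _ _.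
have Ea : a = a' by rewrite -(take_size_cat l ka) E take_size_cat.
have El : l = l' by rewrite -(drop_size_cat l ka) E drop_size_cat.
subst a' l'; suff -> : b = b' by [].
apply: (sorted_eq ord_lt_trans) => //.
  by move=> x y; rewrite /ord_lt => /andP[xy /(ltn_trans xy)]; rewrite ltnn.
by rewrite -(perm_cat2l a) (perm_trans pe) // perm_sym.
Qed.

Lemma word_perm_eq (sigma : 'S_n) : perm_eq (word id sigma) (enum 'I_n).
Proof.
apply: uniq_perm; rewrite ?enum_uniq //.
  by rewrite map_inj_uniq ?enum_uniq //; apply: perm_inj.
move=> x; rewrite mem_enum; apply/mapP.
by exists (sigma^-1%g x); rewrite ?mem_enum // permKV.
Qed.

Lemma sorted_enum_ord : sorted ord_lt (enum 'I_n).
Proof. by rewrite sorted_ord_ltE val_enum_ord iota_ltn_sorted. Qed.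

Lemma shuffleE s (sigma : 'S_n) :
  shuffle s sigma = (word id sigma \in shuffles s (enum 'I_n)).
Proof.
rewrite mem_shuffles ?sorted_enum_ord // word_perm_eq /= size_enum_ord.
rewrite /shuffle (map_comp val) -map_reshape all_map; congr (_ && _).
by apply: eq_all => l; rewrite sorted_ord_ltE.
Qed.

Lemma sum_shuffle (M : zmodType) s (F : seq T -> M) :
  \sum_(sigma : 'S_n | shuffle s sigma) F (word id sigma)
  = \sum_(l <- shuffles s (enum 'I_n)) F l.
Proof.
rewrite -big_filter -(big_map (fun sigma => word id sigma) predT) /=.
apply: perm_big; apply: uniq_perm.
- rewrite map_inj_in_uniq ?filter_uniq ?index_enum_uniq // => sigma tau _ _ E.
  by apply/permP => x; move/eq_in_map: E; apply; rewrite mem_enum.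
- by rewrite uniq_shuffles // sorted_enum_ord.
move=> l; apply/mapP/idP => [[sigma]|lin].
  by rewrite mem_filter shuffleE => /andP[? _] ->.
have := lin; rewrite mem_shuffles ?sorted_enum_ord // => /and3P[pe _ _].
have /tuple_permP[sigma E] : perm_eq l (ord_tuple n) by [].
have El : l = word id sigma.
  by rewrite E /=; apply: eq_map => i; rewrite tnth_ord_tuple.
by exists sigma; rewrite // mem_filter shuffleE -El lin mem_index_enum.
Qed.

End ShuffleLists.

(** * The Koszul sign of a word *)

Section KoszulSign.
Variables (K : fieldType) (n : nat) (d : 'I_n -> int).
Notation T := 'I_n.

(** The part of the Koszul sign due to inversions between a letter of a and a
    letter of b, in the word a ++ b. *)
Definition cross_sign (a b : seq T) : K :=
  \prod_(x <- a) \prod_(y <- b | ord_lt y x) gsign K (d x * d y).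

Fixpoint koszul_word (s : seq T) : K :=
  if s is x :: s' then cross_sign [:: x] s' * koszul_word s' else 1.

Lemma koszul_word_enum m (f : 'I_m -> T) :
  \prod_(a < m) \prod_(b < m | (a < b)%N && (f b < f a)%N)
     gsign K (d (f a) * d (f b)) = koszul_word [seq f a | a <- enum 'I_m].
Proof.
elim: m f => [|m IH] f.
  by rewrite big_ord0; case: (enum _) => [|[]].
rewrite enum_ordSl big_ord_recl /= -map_comp -IH; congr (_ * _).
  rewrite /cross_sign big_seq1 big_map big_enum_cond /=.
  rewrite big_mkcond big_ord_recl /= mul1r -big_mkcond; by apply: eq_bigl => b; rewrite /ord_lt.
apply: eq_bigr => a _; rewrite big_mkcond big_ord_recl /= mul1r [RHS]big_mkcond /=.
by apply: eq_bigr => b _; rewrite /= /bump !add1n ltnS.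
Qed.

Lemma koszulE (sigma : 'S_n) : koszul K d sigma = koszul_word (word id sigma).
Proof. exact: koszul_word_enum. Qed.

(** Together with [koszul_word_cat], this separates the sign of a word into
    independent contributions of its first block and of the rest. *)
Lemma cross_sign_perm a b c : perm_eq b c -> cross_sign a b = cross_sign a c.
Proof. by move=> bc; apply: eq_bigr => x _; apply: perm_big. Qed.

Lemma koszul_word_cat a b :
  koszul_word (a ++ b) = cross_sign a b * (koszul_word a * koszul_word b).
Proof.
elim: a => [|x a IH] /=; first by rewrite /cross_sign big_nil !mul1r.
rewrite IH /cross_sign !big_cons !big_nil big_cat /=; ring.
Qed.

Lemma koszul_word_sorted a : sorted (@ord_lt n) a -> koszul_word a = 1.
Proof.
elim: a => [//|x a IH] xa /=; rewrite IH ?(path_sorted xa) // mulr1.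
rewrite /cross_sign big_seq1 big_seq_cond big_pred0 // => y.
apply/negP => /andP[ya]; have := allP (order_path_min (@ord_lt_trans n) xa) y ya.
by rewrite /ord_lt => /ltnW; rewrite leqNgt => /negP.
Qed.

Variable M : lmodType K.

(** When t is increasing, the sign accumulated by the recursion is the Koszul
    sign: a letter sent to the second word is inverted with exactly the letters
    of the first word that follow it in t. *)
Lemma unshuffle_sum_splits (G : seq T -> seq T -> M) t : sorted (@ord_lt n) t ->
  unshuffle_sum d G t = \sum_(p <- splits t) cross_sign p.1 p.2 *: G p.1 p.2.
Proof.
elim: t G => [|x t IH] G xt; first by rewrite /= big_seq1 /cross_sign big_nil scale1r.
have st := path_sorted xt.
have xlt y : y \in t -> ord_lt x y.
  by move=> yt; apply: (allP (order_path_min (@ord_lt_trans n) xt)).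
rewrite /= big_cat !big_map /= !IH //; congr (_ + _);
  apply: eq_big_seq => -[a b]; rewrite mem_splits // => /and3P[pe _ _] /=.
  rewrite /cross_sign big_cons [X in (X * _) *: _]big1_seq ?mul1r //.
  move=> y /andP[yx yb]; move: yx.
  have := xlt y; rewrite -(perm_mem pe) mem_cat yb orbT => /(_ isT).
  by rewrite /ord_lt => /ltnW; rewrite leqNgt => /negPf ->.
rewrite scalerA; congr (_ *: _).
have -> : cross_sign a (x :: b) = cross_sign a [:: x] * cross_sign a b.
  rewrite /cross_sign -big_split /=; apply: eq_bigr => y _.
  by rewrite !big_cons big_nil; case: ifP => _; rewrite ?mulr1 ?mul1r.
rewrite mulrC; congr (_ * _).
have ax z : z \in a -> ord_lt x z.
  by move=> za; apply: xlt; rewrite -(perm_mem pe) mem_cat za.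
elim: a ax {pe} => [|y a IHa] ax.
  by rewrite /cross_sign big_nil /degs big_nil mulr0 /gsign expr0z.
rewrite degs_cons mulrDr gsignD IHa => [|z za]; last first.
  by apply: ax; rewrite inE za orbT.
rewrite /cross_sign big_cons [in RHS]big_cons big_nil ax ?mem_head // mulr1.
by rewrite mulrC [d x * _]mulrC mulrC.
Qed.

(** Peeling off the first block; iterating it handles shuffles with any number
    of blocks. *)
Lemma sum_shufflesS k s t (F : seq T -> M) : sorted (@ord_lt n) t ->
  \sum_(l <- shuffles (k :: s) t) koszul_word l *: F l
  = unshuffle_sum d (fun a b => if size a == k then
      \sum_(l <- shuffles s b) koszul_word l *: F (a ++ l) else 0) t.
Proof.
move=> st; rewrite /= big_allpairs_dep /= big_filter big_mkcond unshuffle_sum_splits //.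
apply: eq_big_seq => -[a b]; rewrite mem_splits //= => /and3P[pe sa sb].
case: ifP => _; last by rewrite scaler0.
rewrite scaler_sumr; apply: eq_big_seq => l; rewrite mem_shuffles // => /and3P[pl _ _].
rewrite koszul_word_cat (cross_sign_perm _ pl) (koszul_word_sorted sa).
by rewrite mul1r scalerA.
Qed.

Lemma sum_shuffles1 k t (F : seq T -> M) : sorted (@ord_lt n) t ->
  \sum_(l <- shuffles [:: k] t) koszul_word l *: F l
  = if size t == k then F t else 0.
Proof.
move=> st; rewrite sum_shufflesS //.
rewrite -[RHS](unshuffle_sum_counitr d (fun a => if size a == k then F a else 0)).
apply: eq_unshuffle_sum => a [|y b] _ /=; last by rewrite big_nil if_same.
by rewrite big_seq1 cats0 scale1r.
Qed.

Local Arguments shuffles : simpl never.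

Lemma sum_shuffle2 k m (G : seq T -> seq T -> M) : (k + m)%N = n ->
  \sum_(sigma : 'S_n | shuffle [:: k; m] sigma)
    koszul K d sigma *: G (take k (word id sigma)) (drop k (word id sigma))
  = unshuffle_sum d (fun a b => if size a == k then G a b else 0) (enum 'I_n).
Proof.
move=> kmn; under eq_bigr do rewrite koszulE.
rewrite (sum_shuffle _ (fun l => koszul_word l *: G (take k l) (drop k l))).
rewrite (sum_shufflesS _ _ (fun l => G (take k l) (drop k l))) ?sorted_enum_ord //.
rewrite !unshuffle_sum_splits ?sorted_enum_ord //; apply: eq_big_seq => -[a b].
rewrite mem_splits ?sorted_enum_ord // => /and3P[pe _ sb] /=; congr (_ *: _).
case: eqP => // ak; rewrite (sum_shuffles1 _ (fun l => G (take k (a ++ l)) _)) //.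
rewrite take_size_cat // drop_size_cat //.
by rewrite -(eqn_add2l k) kmn -ak -size_cat (perm_size pe) size_enum_ord eqxx.
Qed.

Lemma sum_shuffle3 k m (G : seq T -> T -> seq T -> M) : (k + m.+1)%N = n ->
  \sum_(sigma : 'S_n | shuffle [:: k; 1%N; m] sigma)
    koszul K d sigma *:
      (if drop k (word id sigma) is x :: s then G (take k (word id sigma)) x s
       else 0)
  = unshuffle_sum d (fun a e => if size a == k then
       unshuffle_sum d (fun c b => if c is [:: x] then G a x b else 0) e else 0) (enum 'I_n).
Proof.
move=> kmn; under eq_bigr do rewrite koszulE.
pose F l := if drop k l is x :: s then G (take k l) x s else 0.
rewrite (sum_shuffle _ (fun l => koszul_word l *: F l)) sum_shufflesS ?sorted_enum_ord //.
rewrite !unshuffle_sum_splits ?sorted_enum_ord //; apply: eq_big_seq => -[a e].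
rewrite mem_splits ?sorted_enum_ord // => /and3P[pe _ se] /=; congr (_ *: _).
case: eqP => // ak; rewrite (sum_shufflesS _ _ (fun l => F (a ++ l))) //.
rewrite !unshuffle_sum_splits //; apply: eq_big_seq => -[c b].
rewrite mem_splits // => /and3P[pce _ sb] /=; congr (_ *: _).
case: c pce => [|x [|y c]] //= pce.
rewrite (sum_shuffles1 _ (fun l => F (a ++ x :: l))) // /F.
rewrite take_size_cat // drop_size_cat //.
suff -> : size b == m by [].
have := perm_size pe; have := perm_size pce; rewrite size_cat size_enum_ord /= => <-.
by rewrite ak => sz; have := etrans sz (esym kmn) => /addnI[->].
Qed.

End KoszulSign.

Local Ltac size_lia a b ab := move: (size a) (size b) ab => ? ? ?; lia.

(** * The sums in the defining relations as unshuffle sums *)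

Section PositionSums.
Variables (K : fieldType) (n : nat) (d : 'I_n -> int) (M : lmodType K).
Notation T := 'I_n.

Lemma split_size (a b : seq T) :
  perm_eq (a ++ b) (enum 'I_n) -> (size a + size b = n)%N.
Proof. by move/perm_size; rewrite size_cat size_enum_ord. Qed.

Lemma sum_nat_pick (x : M) k m i : (k <= i < m)%N ->
  \sum_(k <= j < m) (if i == j then x else 0) = x.
Proof.
move=> kim; rewrite -big_mkcond; under eq_bigl do rewrite eq_sym.
by rewrite big_nat1_eq kim.
Qed.

Lemma sum_complement (F : nat -> M) k m s i : (i <= s)%N ->
  \sum_(k <= j < m | (i + j == s)%N) F j
  = if (k <= s - i < m)%N then F (s - i)%N else 0.
Proof.
move=> lis; transitivity (\sum_(k <= j < m | j == (s - i)%N) F j).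
  apply: eq_bigl => j; lia.
exact: big_nat1_eq.
Qed.

(** Summing over the size i of a block removes the size restriction.  Here
    i = 0 is excluded, hence the empty first word contributes nothing. *)
Lemma sum_shuffle_head (G : seq T -> seq T -> M) :
  \sum_(1 <= i < n.+1) \sum_(sigma : 'S_n | shuffle [:: i; (n - i)%N] sigma)
    koszul K d sigma *: G (take i (word id sigma)) (drop i (word id sigma))
  = unshuffle_sum d (fun a b => if a is [::] then 0 else G a b) (enum 'I_n).
Proof.
under eq_big_nat => i /andP[_ lin] do rewrite sum_shuffle2 ?subnKC //.
rewrite unshuffle_sum_sum; apply: eq_unshuffle_sum => -[|x a] b /split_size ab.
  by rewrite big_nat_cond big1 // => -[|i].
by rewrite sum_nat_pick //; move: ab => /= ab; size_lia a b ab.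
Qed.

Lemma sum_shuffle_tail (G : seq T -> seq T -> M) :
  \sum_(1 <= i < n.+2) \sum_(sigma : 'S_n | shuffle [:: (n.+1 - i)%N; i.-1] sigma)
    koszul K d sigma *:
      G (take (n.+1 - i) (word id sigma)) (drop (n.+1 - i) (word id sigma))
  = unshuffle_sum d G (enum 'I_n).
Proof.
under eq_big_nat => i iin do (rewrite sum_shuffle2; last by lia).
rewrite unshuffle_sum_sum; apply: eq_unshuffle_sum => a b /split_size ab.
rewrite -[RHS](@sum_nat_pick (G a b) 1 n.+2 (n.+1 - size a)%N); last by size_lia a b ab.
apply: eq_big_nat => i iin.
by have -> : (size a == n.+1 - i)%N = (n.+1 - size a == i)%N by size_lia a b ab.
Qed.

(** The value i = n + 1, for which no j is left, is harmless: it would require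
    the letter x to be picked from an empty word. *)
Lemma sum_shuffle_pick (G : seq T -> T -> seq T -> M) :
  \sum_(1 <= i < n.+2) \sum_(2 <= j < n.+2 | (i + j == n.+2)%N)
    \sum_(sigma : 'S_n | shuffle [:: i.-1; 1%N; j.-2] sigma)
      koszul K d sigma *:
        (if drop i.-1 (word id sigma) is x :: s then G (take i.-1 (word id sigma)) x s
         else 0)
  = unshuffle_sum d (fun a e => unshuffle_sum d (fun c b =>
      if c is [:: x] then G a x b else 0) e) (enum 'I_n).
Proof.
under eq_big_nat => i iin do (rewrite sum_complement; last by lia).
rewrite big_nat_recr //= subSnn /= addr0.
under eq_big_nat => i iin.
  have -> : (1 < n.+2 - i < n.+2)%N by lia.
  rewrite sum_shuffle3; last by lia.
  over.
rewrite unshuffle_sum_sum; apply: eq_unshuffle_sum => a e /split_size ae.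
case: e ae => [|y e] /= ae; first by rewrite big1 // => i _; rewrite if_same.
rewrite big_add1 /= -[RHS](@sum_nat_pick _ 0 n (size a)) //; size_lia a e ae.
Qed.

Lemma enum_ord_neq (i : 'I_n) :
  [seq j <- enum 'I_n | j != i] = take i (enum 'I_n) ++ drop i.+1 (enum 'I_n).
Proof. by rewrite -rem_filter ?enum_uniq // remE index_enum_ord. Qed.

Lemma sum_drop_enum_ord (i : 'I_n) (F : 'I_n -> int) :
  \sum_(j <- drop i.+1 (enum 'I_n)) F j = \sum_(j < n | (i < j)%N) F j.
Proof.
rewrite -[RHS]big_filter; apply: perm_big; apply: uniq_perm.
- by rewrite drop_uniq ?enum_uniq.
- by rewrite filter_uniq ?index_enum_uniq.
move=> j; rewrite mem_filter mem_index_enum andbT -(mem_map val_inj) map_drop.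
rewrite val_enum_ord drop_iota mem_iota add0n subnKC //.
by rewrite ltn_ord andbT.
Qed.

End PositionSums.

Lemma unshuffle_sum_omit (K : fieldType) (V : gradedSpace K) (n : nat) (d : 'I_n -> int)
    (v : 'I_n -> V) (H : seq V -> V -> V) :
  unshuffle_sum d (fun a s => if s is [:: i] then H (map v a) (v i) else 0) (enum 'I_n)
  = \sum_(i < n) gsign K ((\sum_(j < n | (i < j)%N) d j) * d i) *:
      H [seq v j | j <- enum 'I_n & j != i] (v i).
Proof.
case: n d v => [|n] d v.
  by rewrite big_ord0; case: (enum _) => [|[]].
rewrite (unshuffle_sum_single d ord0 (fun a i => H (map v a) (v i))).
pose F i := gsign K (d (nth ord0 (enum 'I_n.+1) i) * degs d (drop i.+1 (enum 'I_n.+1))) *: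
   H (map v (take i (enum 'I_n.+1) ++ drop i.+1 (enum 'I_n.+1))) (v (nth ord0 (enum 'I_n.+1) i)).
rewrite -(big_mkord xpredT F) size_enum_ord big_mkord; apply: eq_bigr => i _.
by rewrite /F nth_ord_enum -enum_ord_neq /degs sum_drop_enum_ord mulrC.
Qed.

(** * Multilinear extension from homogeneous elements *)

Section LinearExtension.
Variables (K : fieldType) (U : gradedSpace K).
Local Notation T := (int * U)%type.

Lemma gdecomp_homogeneous (x : U) : homogeneous (gdecomp x).
Proof. by have /and3P[] := xchooseP (gcomp_span x). Qed.

Lemma sum_snd_gdecomp (x : U) : \sum_(p <- gdecomp x) p.2 = x.
Proof. by have /and3P[_ _ /eqP] := xchooseP (gcomp_span x). Qed.

(** The decompositions of x, y and k *: x + y are chosen independently and may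
    involve different degrees; independence of the components forces their
    projections to any common list of degrees to be related linearly. *)
Lemma sum_gdecomp_linear (M : lmodType K) (G : int * U -> M) :
  (forall c, linear (fun x => G (c, x))) ->
  linear (fun x => \sum_(p <- gdecomp x) G p).
Proof.
move=> Glin k x y.
have G0 c : G (c, 0) = 0.
  by have := Glin c (-1) 0 0; rewrite !scaleN1r oppr0 addr0 addNr.
have GD c u v : G (c, u + v) = G (c, u) + G (c, v).
  by have := Glin c 1 u v; rewrite !scale1r.
have GZ c u : G (c, k *: u) = k *: G (c, u).
  by have := Glin c k u 0; rewrite G0 !addr0.
pose z := k *: x + y.
pose D := undup (unzip1 (gdecomp x ++ gdecomp y ++ gdecomp z)).
pose proj (c : int) (u : U) : U := \sum_(p <- gdecomp u | p.1 == c) p.2.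
have projG u : {subset unzip1 (gdecomp u) <= D} ->
    forall (N : lmodType K) (H : int * U -> N),
      (forall c u v, H (c, u + v) = H (c, u) + H (c, v)) ->
      (forall c, H (c, 0) = 0) ->
    \sum_(p <- gdecomp u) H p = \sum_(c <- D) H (c, proj c u).
  move=> uD N H HD H0.
  transitivity (\sum_(p <- gdecomp u) \sum_(c <- D | c == p.1) H p).
    apply: eq_big_seq => p pu; rewrite big_mkcond (bigD1_seq p.1) ?undup_uniq //=.
      by rewrite eqxx big1 ?addr0 // => c /negPf ->.
    by apply: uD; apply: map_f.
  rewrite (exchange_big_dep predT) //=; apply: eq_bigr => c _.
  rewrite /proj (big_morph (fun v => H (c, v)) (HD c) (H0 c)).
  by under eq_bigl do rewrite eq_sym; apply: eq_bigr => -[c' v] /= /eqP ->.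
have sub u : u \in [:: x; y; z] -> {subset unzip1 (gdecomp u) <= D}.
  move=> uin c; rewrite /D mem_undup /unzip1 !map_cat !mem_cat.
  by move: uin; rewrite !inE => /or3P[] /eqP-> ->; rewrite ?orbT.
have projU u : u \in [:: x; y; z] -> u = \sum_(c <- D) proj c u.
  move=> /sub uD; rewrite -[LHS]sum_snd_gdecomp.
  exact: (projG u uD U (fun p => p.2)).
have proj_in c u : proj c u \in gcomp U c.
  have [z0 lind] := gcomp_submod U c.
  rewrite /proj big_seq_cond; apply: (big_ind (fun v => v \in gcomp U c)) => // [a b ac bc|p].
    by rewrite -[a]scale1r lind.
  by case/andP=> pt /eqP <-; apply: (allP (gdecomp_homogeneous u)).
have proj_lin c : c \in D -> proj c z = k *: proj c x + proj c y.
  move=> cD; apply/eqP; rewrite -subr_eq0 -opprB oppr_eq0; apply/eqP.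
  pose w c := k *: proj c x + proj c y - proj c z.
  have win : forall p, p \in [seq (c, w c) | c <- D] -> p.2 = 0.
    apply: gcomp_indep.
    - by rewrite /unzip1 -map_comp map_id undup_uniq.
    - apply/allP=> _ /mapP[c' _ ->] /=; have [z0 lind] := gcomp_submod U c'.
      by rewrite /w addrC -scaleN1r !lind // -[_ *: _]addr0 lind.
    rewrite big_map big_split big_split /= sumrN -scaler_sumr.
    by rewrite -!projU ?inE ?eqxx ?orbT // subrr.
  by apply: (win (c, w c)); apply: map_f.
rewrite !(projG _ (sub _ _) M G) ?inE ?eqxx ?orbT // scaler_sumr -big_split /=.
by apply: eq_big_seq => c cD; rewrite proj_lin // GD GZ.
Qed.

Variable W : gradedSpace K.
Implicit Types (F : seq T -> W).

(** The degree attached to the letter is kept fixed, even when the letter is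
    not homogeneous of that degree: signs depend on the degrees only. *)
Definition slot_linear (M : lmodType K) (F : seq T -> M) :=
  forall t1 t2 c k x y,
    F (t1 ++ (c, k *: x + y) :: t2)
    = k *: F (t1 ++ (c, x) :: t2) + F (t1 ++ (c, y) :: t2).

Definition graded_symmetric (M : lmodType K) (F : seq T -> M) :=
  forall t1 t2 p q x y, x \in gcomp U p -> y \in gcomp U q ->
    F (t1 ++ [:: (p, x), (q, y) & t2])
    = gsign K (p * q) *: F (t1 ++ [:: (q, y), (p, x) & t2]).

Lemma multilinear_ext_comb k F F' F'' s :
  (forall t, F t = k *: F' t + F'' t) ->
  multilinear_ext F s
  = k *: multilinear_ext F' s + multilinear_ext F'' s.
Proof.
elim: s F F' F'' => [|x s IH] F F' F'' FE /=; first exact: FE.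
by rewrite scaler_sumr -big_split; apply: eq_bigr => p _; apply: IH.
Qed.

Lemma slot_linear_cons (M : lmodType K) (F : seq T -> M) p :
  slot_linear F -> slot_linear (fun t => F (p :: t)).
Proof. by move=> FL t1 t2 c k x y; apply: (FL (p :: t1)). Qed.

Lemma multilinear_ext_linear F s1 s2 k x y : slot_linear F ->
  multilinear_ext F (s1 ++ (k *: x + y) :: s2)
  = k *: multilinear_ext F (s1 ++ x :: s2) + multilinear_ext F (s1 ++ y :: s2).
Proof.
elim: s1 F => [|z s1 IH] F FL /=.
  apply: (sum_gdecomp_linear (G := fun p => multilinear_ext (fun t => F (p :: t)) s2)).
  move=> c k' x' y'; apply: multilinear_ext_comb => t; exact: (FL [::]).
rewrite scaler_sumr -big_split; apply: eq_bigr => p _.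
by apply: IH; apply: slot_linear_cons.
Qed.

Lemma multilinear_ext_sym F s1 s2 p q x y :
  slot_linear F -> graded_symmetric F ->
  x \in gcomp U p -> y \in gcomp U q ->
  multilinear_ext F (s1 ++ [:: x, y & s2])
  = gsign K (p * q) *: multilinear_ext F (s1 ++ [:: y, x & s2]).
Proof.
move=> FL FS xp yq; elim: s1 F FL FS => [|z s1 IH] F FL FS /=; last first.
  rewrite scaler_sumr; apply: eq_bigr => r _; apply: IH; first exact: slot_linear_cons.
  by move=> t1 t2; apply: (FS (r :: t1)).
have F0 t1 t2 c : F (t1 ++ (c, 0) :: t2) = 0.
  have := FL t1 t2 c (-1) 0 0.
  by rewrite !scaleN1r oppr0 addr0 addNr.
have ext0 (H : seq T -> W) s : (forall t, H t = 0) -> multilinear_ext H s = 0.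
  elim: s H => [|u s IH] H H0 /=; first exact: H0.
  by rewrite big1 // => r _; apply: IH.
have two p' q' x' y' : x' \in gcomp U p' -> y' \in gcomp U q' ->
    multilinear_ext F [:: x', y' & s2]
    = multilinear_ext (fun t => F [:: (p', x'), (q', y') & t]) s2.
  move=> xp' yq' /=.
  rewrite (sum_gdecomp (G := fun r => \sum_(r' <- gdecomp y')
    multilinear_ext (fun t => F [:: r, r' & t]) s2) xp'); last first.
    by move=> c; rewrite big1 // => r _; apply: ext0 => t; apply: (F0 [::]).
  rewrite (sum_gdecomp (G := fun r => multilinear_ext (fun t => F [:: _, r & t]) s2) yq') //.
  by move=> c; apply: ext0 => t; apply: (F0 [:: _]).
have := two _ _ _ _ xp yq; have := two _ _ _ _ yq xp => /= -> ->.
rewrite -[RHS]addr0 -[X in _ + X](ext0 (fun _ => 0) s2 (fun _ => erefl)).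
by apply: multilinear_ext_comb => t; rewrite addr0; apply: (FS [::]).
Qed.

End LinearExtension.

(** * The sub-adjacent operations *)

Section UnshuffleSumSlots.
Variables (K : fieldType) (U : gradedSpace K) (M : lmodType K).
Local Notation T := (int * U)%type.
Implicit Types (G : seq T -> seq T -> M).
Local Notation usum := (unshuffle_sum (@fst int U)).

Lemma unshuffle_sum_slot_linear G :
  (forall b, slot_linear (G ^~ b)) -> (forall a, slot_linear (G a)) ->
  slot_linear (usum G).
Proof.
move=> G1 G2 t1 t2 c k x y; elim: t1 G G1 G2 => [|p t1 IH] G G1 G2 /=.
  rewrite scalerDr addrACA -!unshuffle_sumZ; congr (_ + _);
    rewrite -unshuffle_sumD; apply: eq_unshuffle_sum => a b _.
    exact: (G1 b [::]).
  by rewrite (G2 a [::]) scalerDr !scalerA mulrC.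
rewrite !IH.
- by rewrite scalerDr addrACA.
- move=> b u1 u2 c' k' x' y'; rewrite G1 scalerDr !scalerA mulrC.
  by rewrite !degs_cat !degs_cons.
- by move=> a u1 u2 c' k' x' y'; rewrite (G2 a (p :: u1)) scalerDr !scalerA mulrC.
- by move=> b u1 u2 c' k' x' y'; rewrite (G1 b (p :: u1)).
- by move=> a u1 u2 c' k' x' y'; rewrite G2.
Qed.

(** If the two exchanged letters go to different words, exchanging them permutes
    these terms and the sign comes from the recursion; otherwise it comes from
    the symmetry of G in one of its words. *)
Lemma unshuffle_sum_sym G :
  (forall b, graded_symmetric (G ^~ b)) -> (forall a, graded_symmetric (G a)) ->
  graded_symmetric (usum G).
Proof.
move=> G1 G2 t1 t2 p q x y xp yq; elim: t1 G G1 G2 => [|r t1 IH] G G1 G2 /=.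
  rewrite !scalerDr -!unshuffle_sumZ -!addrA; congr (_ + _).
    by apply: eq_unshuffle_sum => a b _; apply: (G1 b [::]).
  rewrite addrA [RHS]addrA; congr (_ + _); last first.
    apply: eq_unshuffle_sum => a b _; rewrite (G2 a [::] _ _ _ _ _ xp yq) !scalerA.
    by congr (_ *: _); ring.
  rewrite addrC; congr (_ + _); apply: eq_unshuffle_sum => a b _.
    by rewrite degs_cons mulrDr gsignD scalerA.
  by rewrite degs_cons mulrDr gsignD scalerA mulrA [(q * p)%R]mulrC gsign_sqr mul1r.
rewrite scalerDr !IH //.
- move=> b u1 u2 p' q' x' y' xp' yq'; rewrite (G1 _ _ _ _ _ _ _ xp' yq') !scalerA.
  rewrite !degs_cat !degs_cons mulrC; congr (_ * gsign K (_ * _) *: _); ring.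
- move=> a u1 u2 p' q' x' y' xp' yq'.
  by rewrite (G2 a (r :: u1) _ _ _ _ _ xp' yq') !scalerA mulrC.
- by move=> b u1 u2 p' q' x' y' xp' yq'; apply: (G1 b (r :: u1)).
Qed.

End UnshuffleSumSlots.

Section SubAdjacent.
Variables (K : fieldType) (V : gradedSpace K) (theta : seq V -> V -> V).
Hypothesis thetaM : sym_tensor_maps theta.
Local Notation T := (int * V)%type.
Local Notation usum := (unshuffle_sum (@fst int V)).
Local Notation degs := (degs (@fst int V)).
Local Notation l := (subadjacent theta).

(** theta with its last argument given as a word: it selects the terms of an
    unshuffle sum in which this word is a single letter. *)
Definition theta_last (a s : seq T) : V :=
  if s is [:: p] then theta (unzip2 a) p.2 else 0.

Lemma theta_slot_linear w : slot_linear (fun a : seq T => theta (unzip2 a) w).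
Proof. by move=> t1 t2 c k x y; rewrite /unzip2 !map_cat (stm_linear_sym thetaM). Qed.

Lemma theta_graded_sym w :
  graded_symmetric (fun a : seq T => theta (unzip2 a) w).
Proof.
by move=> t1 t2 p q x y xp yq; rewrite /unzip2 !map_cat (stm_sym thetaM _ _ _ xp yq).
Qed.

Lemma theta0 s : theta s 0 = 0.
Proof.
have := stm_linear thetaM s (-1) 0 0.
by rewrite scaler0 add0r scaleN1r addNr.
Qed.

Lemma theta_head0 s w : theta (0 :: s) w = 0.
Proof.
have := stm_linear_sym thetaM [::] s (-1) 0 0 w.
by rewrite /= scaler0 add0r scaleN1r addNr.
Qed.

(** This is what makes the coalgebra identities apply to l. *)
Lemma subadjacent_homE (t : seq T) : subadjacent_hom theta t = usum theta_last t.
Proof.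
rewrite (unshuffle_sum_single _ (0, 0) (fun a p => theta (unzip2 a) p.2)) /subadjacent_hom.
apply: eq_bigr => i _.
rewrite !(nth_map (0, 0)) ?ltn_ord // /unzip1 /unzip2 map_cat map_take !map_drop.
by rewrite -map_drop big_map.
Qed.

Lemma theta_last_linearl b : slot_linear (theta_last ^~ b).
Proof.
rewrite /theta_last; case: b => [|p [|q b]] t1 t2 c k x y; rewrite ?scaler0 ?addr0 //.
exact: theta_slot_linear.
Qed.

Lemma theta_last_linearr a : slot_linear (theta_last a).
Proof.
move=> [|p t1] t2 c k x y; last by case: t1 => [|? ?]; rewrite /= scaler0 addr0.
by case: t2 => [|? ?] /=; rewrite ?scaler0 ?addr0 // (stm_linear thetaM).
Qed.

Lemma theta_last_syml b : graded_symmetric (theta_last ^~ b).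
Proof.
rewrite /theta_last; case: b => [|r [|r' b]] t1 t2 p q x y xp yq; rewrite ?scaler0 //.
exact: theta_graded_sym.
Qed.

Lemma theta_last_symr a : graded_symmetric (theta_last a).
Proof. by move=> [|? [|? ?]] t2 p q x y _ _; rewrite /= scaler0. Qed.

Lemma subadjacent_hom_linear : slot_linear (subadjacent_hom theta).
Proof.
move=> *; rewrite !subadjacent_homE; apply: unshuffle_sum_slot_linear.
  exact: theta_last_linearl.
exact: theta_last_linearr.
Qed.

Lemma subadjacent_hom_sym : graded_symmetric (subadjacent_hom theta).
Proof.
move=> *; rewrite !subadjacent_homE; apply: unshuffle_sum_sym => //.
  exact: theta_last_syml.
exact: theta_last_symr.
Qed.

Lemma subadjacent_unshuffle_sum (t : seq T) :
  homogeneous t -> l (unzip2 t) = usum theta_last t.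
Proof. by move=> ht; rewrite subadjacentE // subadjacent_homE. Qed.

Lemma unshuffle_sum_closed (S : {pred V}) (G : seq T -> seq T -> V) t :
  submod_closed S -> (forall a b, perm_eq (a ++ b) t -> G a b \in S) ->
  usum G t \in S.
Proof.
case=> S0 SL; elim: t G => [|x t IH] G GS /=; first exact: GS.
rewrite -[X in X + _]scale1r SL // IH // => a b ab; first by rewrite GS //= perm_cons.
by rewrite -[X in X \in _]addr0 SL // GS // (perm_catCA a [:: x] b) perm_cons.
Qed.

Lemma subadjacent_degree (t : seq T) : homogeneous t ->
  l (unzip2 t) \in gcomp V (degs t + 1).
Proof.
move=> ht; rewrite subadjacent_unshuffle_sum //.
apply: unshuffle_sum_closed; first exact: gcomp_submod.
have [z0 _] := gcomp_submod V (degs t + 1).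
move=> a [|p [|q b]] // ab; move: ht.
rewrite /homogeneous -(perm_all _ ab) all_cat /= andbT => /andP[ha hp].
rewrite -(degs_perm _ ab) degs_cat degs_cons [degs [::]]big_nil addr0.
exact: (stm_degree1 thetaM).
Qed.

Lemma subadjacent_sym_maps : sym_maps l.
Proof.
split.
- by move=> *; apply: multilinear_ext_linear; apply: subadjacent_hom_linear.
- move=> *; apply: multilinear_ext_sym => //.
    exact: subadjacent_hom_linear.
  exact: subadjacent_hom_sym.
by move=> t _; apply: subadjacent_degree.
Qed.

End SubAdjacent.

(** * The relations *)

Section Relations.
Variables (K : fieldType) (V : gradedSpace K) (theta : seq V -> V -> V).
Hypothesis theta_preLie : preLie_infty theta.
Let thetaM : sym_tensor_maps theta := pl_maps theta_preLie.
Local Notation T := (int * V)%type.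
Local Notation usum := (unshuffle_sum (@fst int V)).
Local Notation degs := (degs (@fst int V)).
Local Notation l := (subadjacent theta).

Lemma wordE n X (v : 'I_n -> X) (sigma : 'S_n) : word v sigma = map v (word id sigma).
Proof. by rewrite /word -map_comp. Qed.

Lemma size_word n X (v : 'I_n -> X) (sigma : 'S_n) : size (word v sigma) = n.
Proof. by rewrite size_map size_enum_ord. Qed.

Lemma subadjacent_nil : l [::] = 0.
Proof. by rewrite (subadjacent_unshuffle_sum thetaM (t := [::])). Qed.

Lemma linear_theta_head s w : linear (fun y => theta (y :: s) w).
Proof. by move=> k x y; apply: (stm_linear_sym thetaM [::]). Qed.

Lemma unzip2_family n (d : 'I_n -> int) (v : 'I_n -> V) s :
  unzip2 [seq (d a, v a) | a <- s] = map v s.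
Proof. by rewrite /unzip2 -map_comp. Qed.

(** The summand common to the pre-Lie relation and the representation relation. *)
Definition nested_last (w : V) (a b : seq T) : V :=
  gsign K (degs a) *: theta (unzip2 a) (theta (unzip2 b) w).

Lemma nested_last_sumE n (d : 'I_n -> int) (v : 'I_n -> V) w :
  \sum_(1 <= i < n.+2)
    \sum_(sigma : 'S_n | shuffle [:: (n.+1 - i)%N; i.-1] sigma)
      (koszul K d sigma *
       gsign K (\sum_(c <- take (n.+1 - i) (word d sigma)) c)) *:
        (let y := word v sigma in
         theta (take (n.+1 - i) y) (theta (drop (n.+1 - i) y) w))
  = usum (nested_last w) [seq (d a, v a) | a <- enum 'I_n].
Proof.
rewrite (unshuffle_sum_map (deg := d)) // -sum_shuffle_tail.
apply: eq_bigr => i _; apply: eq_bigr => sigma _.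
rewrite /nested_last !unzip2_family /degs big_map !(wordE v) !map_take !map_drop.
by rewrite scalerA (wordE d) -map_take big_map.
Qed.

(** Stated for any map rho that vanishes when its first argument does, in order
    to serve both for the representation relation (rho = theta) and for the
    L_infty relation (rho = l, constant in its last argument). *)
Lemma nested_first_sumE n (d : 'I_n -> int) (v : 'I_n -> V)
    (rho : seq V -> V -> V) w :
  (forall s, rho (0 :: s) w = 0) ->
  \sum_(1 <= i < n.+1) \sum_(sigma : 'S_n | shuffle [:: i; (n - i)%N] sigma)
      koszul K d sigma *:
        (let y := word v sigma in rho (l (take i y) :: drop i y) w)
  = usum (fun a b => rho (l (unzip2 a) :: unzip2 b) w)
      [seq (d a, v a) | a <- enum 'I_n].
Proof.
move=> rho0; rewrite (unshuffle_sum_map (deg := d)) //.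
transitivity (unshuffle_sum d (fun a b => if a is [::] then 0 else
   rho (l (map v a) :: map v b) w) (enum 'I_n)); last first.
  apply: eq_unshuffle_sum => -[|x a] b _; first by rewrite /= subadjacent_nil rho0.
  by rewrite !unzip2_family.
rewrite -(sum_shuffle_head d (fun a b => rho (l (map v a) :: map v b) w)).
apply: eq_bigr => i _; apply: eq_bigr => sigma _ /=.
by rewrite (wordE v) map_take map_drop.
Qed.

(** The pre-Lie relation in terms of l: in the first sum the letter x picked by
    the middle block of a shuffle is the last argument of the inner theta, and
    by coassociativity the sum over x can be performed inside the outer theta,
    where it produces l. *)
Lemma preLie_unshuffle_sum t e w : homogeneous t -> w \in gcomp V e ->
  usum (fun a b => theta (l (unzip2 a) :: unzip2 b) w) t
  + usum (nested_last w) t = 0.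
Proof.
move=> ht we; pose x0 : T := (0, 0).
pose d (i : 'I_(size t)) := (nth x0 t i).1.
pose v (i : 'I_(size t)) := (nth x0 t i).2.
have tE : t = [seq (d a, v a) | a <- enum 'I_(size t)].
  rewrite -[LHS](mkseq_nth x0) /mkseq -val_enum_ord -map_comp.
  by apply: eq_map => i /=; rewrite -surjective_pairing.
have hv a : v a \in gcomp V (d a) by apply: (all_nthP x0 ht).
rewrite -[RHS](pl_rel theta_preLie hv we) [in LHS]tE -nested_last_sumE.
congr (_ + _); last first.
  apply: eq_big_nat => i iin; rewrite sum_complement; last by lia.
  have -> : (0 < (size t).+2 - i < (size t).+2)%N by lia.
  have -> : ((size t).+2 - i).-1 = ((size t).+1 - i)%N by lia.
  by apply: eq_bigr => sigma _; rewrite mulrC.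
transitivity (usum (fun a e => usum (fun c b =>
    if c is [:: p] then theta (theta (unzip2 a) p.2 :: unzip2 b) w else 0) e)
    [seq (d a, v a) | a <- enum 'I_(size t)]).
  rewrite -(unshuffle_sum_coassoc _ (fun a c b =>
    if c is [:: p] then theta (theta (unzip2 a) p.2 :: unzip2 b) w else 0)) -tE.
  apply: eq_unshuffle_sum => a b ab; have ha : homogeneous a.
    by move: ht; rewrite /homogeneous -(perm_all _ ab) all_cat => /andP[].
  rewrite subadjacent_unshuffle_sum //.
  rewrite (unshuffle_sum_linear _ _ _ (linear_theta_head _ _)).
  apply: eq_unshuffle_sum => c [|p [|q s]] _ //=; exact: theta_head0.
rewrite (unshuffle_sum_map (deg := d)) //.
transitivity (unshuffle_sum d (fun a e => unshuffle_sum d (fun c b =>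
    if c is [:: x] then theta (theta (map v a) (v x) :: map v b) w else 0) e)
    (enum 'I_(size t))).
  apply: eq_unshuffle_sum => a e' _; rewrite (unshuffle_sum_map (deg := d)) //.
  by apply: eq_unshuffle_sum => -[|x [|y c]] b _ //=; rewrite !unzip2_family.
rewrite -(sum_shuffle_pick d (fun a x b => theta (theta (map v a) (v x) :: map v b) w)).
apply: eq_big_nat => i iin; rewrite big_nat_cond [RHS]big_nat_cond.
apply: eq_bigr => j jin.
apply: eq_bigr => sigma _ /=.
have lti : (i.-1 < size (word id sigma))%N by rewrite size_word; lia.
have x1 : 'I_(size t) by rewrite size_word in lti; apply: (Ordinal lti).
rewrite (drop_nth x1) // (wordE v) (nth_map x1) // -map_take -map_drop prednK //; lia.
Qed.

(** Both halves of the expansion of l(l(a), b) are sums over the letter x in the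
    last slot, and for each x they add up to the pre-Lie relation for the
    remaining letters, with w = x. *)
Lemma subadjacent_Jacobi t : homogeneous t ->
  usum (fun a b => l (l (unzip2 a) :: unzip2 b)) t = 0.
Proof.
(* The letter l(a) together with its degree, so that it can be part of a word. *)
move=> ht; pose la a : T := (degs a + 1, l (unzip2 a)).
transitivity (usum (fun a b => usum (fun u s => theta_last theta (la a :: u) s) b) t
  + usum (fun a b => usum (fun c s => gsign K (degs a) *:
        theta (unzip2 a) (theta_last theta c s)) b) t).
  (* Expand the outer l: the letter l(a) heads its word, and is either kept in
     the symmetric arguments of theta or sent to the last slot. *)
  transitivity (usum (fun a b => usum (fun u s => theta_last theta (la a :: u) s) b
      + gsign K ((degs a + 1) * degs b) *: theta (unzip2 b) (l (unzip2 a))) t).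
    apply: eq_unshuffle_sum => a b ab; move: (ht).
    rewrite /homogeneous -(perm_all _ ab) all_cat => /andP[ha hb].
    have hab : homogeneous (la a :: b).
      by rewrite /homogeneous /= hb andbT; apply: subadjacent_degree.
    rewrite -[_ :: _]/(unzip2 (la a :: b)) subadjacent_unshuffle_sum //=; congr (_ + _).
    rewrite -[RHS](unshuffle_sum_counitr (@fst int V) (fun u =>
      gsign K ((degs a + 1) * degs b) *: theta (unzip2 u) (l (unzip2 a)))).
    apply: eq_unshuffle_sum => u [|s s'] us /=; last by rewrite scaler0.
    by rewrite cats0 in us; rewrite (degs_perm _ us).
  rewrite unshuffle_sumD; congr (_ + _).
  (* Moving l(a) past b costs (|a| + 1)|b|; exchanging a and b in the coproduct
     gives back |a||b|, so (-1)^|b| remains, which is (-1)^|a| after renaming. *)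
  transitivity (usum (fun a b => gsign K (degs a) *: theta (unzip2 a) (l (unzip2 b))) t).
    rewrite [RHS]unshuffle_sum_cocomm; apply: eq_unshuffle_sum => a b _.
    by rewrite scalerA -gsignD mulrDl mul1r.
  apply: eq_unshuffle_sum => a b ab; have hb : homogeneous b.
    by move: ht; rewrite /homogeneous -(perm_all _ ab) all_cat => /andP[].
  rewrite unshuffle_sumZ -(unshuffle_sum_linear _ _ _ (stm_linear thetaM _)).
  by rewrite subadjacent_unshuffle_sum.
rewrite -(unshuffle_sum_coassoc _ (fun a u s => theta_last theta (la a :: u) s)).
rewrite -(unshuffle_sum_coassoc _ (fun a c s =>
  gsign K (degs a) *: theta (unzip2 a) (theta_last theta c s))).
rewrite -unshuffle_sumD -[RHS](unshuffle_sum0 (@fst int V) V t).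
apply: eq_unshuffle_sum => e [|x [|y s]] es.
- rewrite -unshuffle_sumD -[RHS](unshuffle_sum0 (@fst int V) V e).
  apply: eq_unshuffle_sum => a b _.
  by rewrite /= (theta0 thetaM) scaler0 addr0.
- move: ht; rewrite /homogeneous -(perm_all _ es) all_cat => /and3P[he hx _].
  exact: (preLie_unshuffle_sum he hx).
rewrite -unshuffle_sumD -[RHS](unshuffle_sum0 (@fst int V) V e).
apply: eq_unshuffle_sum => a b _.
by rewrite /= (theta0 thetaM) scaler0 addr0.
Qed.

Lemma subadjacent_L_infty : L_infty l.
Proof.
split; first exact: subadjacent_sym_maps.
move=> n d x _ hx.
rewrite (@nested_first_sumE n d x (fun s _ => l s) 0).
  apply: subadjacent_Jacobi; apply/allP => _ /mapP[a _ ->]; exact: hx.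
move=> s; have := sm_linear (subadjacent_sym_maps thetaM) [::] s (-1) 0 0.
by rewrite /= scaler0 add0r scaleN1r addNr.
Qed.

Lemma left_multiplication_rep : L_infty_rep l theta.
Proof.
split; [exact: subadjacent_L_infty | exact: thetaM |].
move=> n d x e v hx ve.
rewrite nested_first_sumE ?nested_last_sumE; last by move=> s; apply: theta_head0.
by apply: (preLie_unshuffle_sum _ ve); apply/allP => _ /mapP[a _ ->]; apply: hx.
Qed.

Lemma subadjacent_identity_RB : strict_homotopy_relative_RB l theta id.
Proof.
split=> //; first exact: left_multiplication_rep.
move=> p d v _ hv.
have h : homogeneous [seq (d a, v a) | a <- enum 'I_p].
  by apply/allP => _ /mapP[a _ ->]; apply: hv.
rewrite -(unzip2_family d v) (subadjacent_unshuffle_sum thetaM h).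
rewrite (unshuffle_sum_map (deg := d)) // -(unshuffle_sum_omit d v theta).
by apply: eq_unshuffle_sum => a [|x [|y s]] _ //=; rewrite unzip2_family.
Qed.

End Relations.

Theorem proposition5p17 (K : fieldType) (charK0 : [pchar K] =i pred0)
    (g : gradedSpace K) (theta : seq g -> g -> g)
    (theta_preLie : preLie_infty theta) :
  let L := fun (s : seq g) (x : g) => theta s x in
  L_infty_rep (subadjacent theta) L
  /\ strict_homotopy_relative_RB (subadjacent theta) L (@id g).
Proof.
split; first exact: left_multiplication_rep.
exact: subadjacent_identity_RB.
Qed.
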